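(* Let $X,Y\in\mathrm{Sym}^+(2)$, let $d_1,d_2$ be the eigenvalues of $X$ and $\lambda_1,\lambda_2$ the eigenvalues of $Y$. The scaling–rotation distance is computed as follows. (i) If $d_1\ne d_2$ and $\lambda_1\ne\lambda_2$, then there are exactly four versions of $X$, denoted by $(U_i,D_i)$, $i=1,\dots,4$, and for any version $(V,\Lambda)$ of $Y$, $$d_{\mathcal{SR}}(X,Y)=\min_{i=1,\dots,4}d\big((U_i,D_i),(V,\Lambda)\big).$$ These versions are given by the permutations and sign changes: for any one version $(U,D)$ of $X$, they are the pairs $(UI_\sigma P_\pi',D_\pi)$ with $\sigma\in\boldsymbol{\sigma}_2^+$, $\pi\in S_2$. (ii) If $d_1=d_2$, then with $D=\mathrm{diag}(d_1,d_1)$, for any version $(V,\Lambda)$ of $Y$, $$d_{\mathcal{SR}}(X,Y)=d\big((V,D),(V,\Lambda)\big),$$ regardless of whether the eigenvalues of $Y$ are distinct or not.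
   Context: A prime denotes transpose. $\mathrm{Sym}^+(p)$ is the set of real symmetric positive-definite $p\times p$ matrices; $\mathrm{SO}(p)$ the set of rotation matrices; $\mathrm{Diag}^+(p)$ the set of diagonal matrices with positive diagonal entries (in no particular order). A version of $X\in\mathrm{Sym}^+(p)$ is a pair $(U,D)\in\mathrm{SO}(p)\times\mathrm{Diag}^+(p)$ with $X=UDU'$; $\mathcal{E}_X$ is the set of all versions of $X$. Fix $k>0$. On $\mathrm{SO}(p)\times\mathrm{Diag}^+(p)$ the geodesic distance $d$ is $$d^2\big((U,D),(V,\Lambda)\big)=\frac{k}{2}\|\log(VU')\|_F^2+\|\log(\Lambda D^{-1})\|_F^2,$$ where $\|\cdot\|_F$ is the Frobenius norm; for $R\in\mathrm{SO}(p)$, $\log(R)$ is an antisymmetric $A$ with $\exp(A)=R$ of smallest Frobenius norm (any choice if not unique), and on $\mathrm{Diag}^+(p)$ $\log$ is the entrywise logarithm of the diagonal. The scaling–rotation distance is $d_{\mathcal{SR}}(X,Y)=\inf\{d((U,D),(V,\Lambda)):(U,D)\in\mathcal{E}_X,\ (V,\Lambda)\in\mathcal{E}_Y\}$. For $\pi\in S_p$ (permutations of $\{1,\dots,p\}$), $P_\pi^0$ is the matrix whose entries are all $0$ except that in column $i$ the entry in row $\pi(i)$ equals $1$; $P_\pi=P_\pi^0$ if $\det P_\pi^0=1$, and $P_\pi=\mathrm{diag}(-1,1,\dots,1)P_\pi^0$ otherwise; $D_\pi=P_\pi DP_\pi'$. $\boldsymbol{\sigma}_p^+=\{(\epsilon_1,\dots,\epsilon_p):\epsilon_i\in\{\pm1\},\prod_i\epsilon_i=1\}$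 and $I_\sigma=\mathrm{diag}(\epsilon_1,\dots,\epsilon_p)$. *)

(* Defs.v *)
From HB Require Import structures.
From mathcomp Require Export all_boot all_order all_algebra all_fingroup.
From mathcomp Require Export all_classical all_reals all_analysis.
Export Order.TTheory GRing.Theory Num.Theory.
Export numFieldNormedType.Exports.

Set Implicit Arguments.
Unset Strict Implicit.
Unset Printing Implicit Defensive.

Global Open Scope classical_set_scope.
Global Open Scope ring_scope.

Definition sym_posdef (R : realType) (p : nat) : set 'M[R]_p :=
  [set X | X^T = X /\ forall v : 'cV[R]_p, v != 0 -> 0 < (v^T *m X *m v) 0 0].

Definition rotations (R : realType) (p : nat) : set 'M[R]_p :=
  [set U | U *m U^T = 1%:M /\ \det U = 1].

Definition pos_diag (R : realType) (p : nat) : set 'M[R]_p :=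
  [set D | is_diag_mx D /\ forall i, 0 < D i i].

Definition versions (R : realType) (p : nat) (X : 'M[R]_p) :
    set ('M[R]_p * 'M[R]_p) :=
  [set UD | [/\ @rotations R p UD.1, @pos_diag R p UD.2 &
             X = UD.1 *m UD.2 *m UD.1^T]].

(* The norm that the library puts on matrices is the max norm. *)
Definition frobenius (R : realType) (p : nat) (A : 'M[R]_p) : R :=
  Num.sqrt (\sum_i \sum_j A i j ^+ 2).

Definition expmx (R : realType) (p : nat) (A : 'M[R]_p) : 'M[R]_p :=
  limn (series (fun n => n`!%:R^-1 *: A ^+ n)).

Definition is_rot_log (R : realType) (p : nat) (Q A : 'M[R]_p) : Prop :=
  [/\ A^T = - A, expmx A = Q &
      forall B : 'M[R]_p, B^T = - B -> expmx B = Q ->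
        frobenius A <= frobenius B].

(* An arbitrary choice when the logarithm of minimal norm is not unique; 0 is
   only a default for matrices without logarithm, hence never for rotations. *)
Definition rot_log (R : realType) (p : nat) (Q : 'M[R]_p) : 'M[R]_p :=
  xget 0 [set A | is_rot_log Q A].

Definition diag_log (R : realType) (p : nat) (D : 'M[R]_p) : 'M[R]_p :=
  diag_mx (\row_i ln (D i i)).

Definition geo_dist (R : realType) (p : nat) (k : R)
    (UD VL : 'M[R]_p * 'M[R]_p) : R :=
  Num.sqrt (k / 2 * frobenius (rot_log (VL.1 *m UD.1^T)) ^+ 2
            + frobenius (diag_log (VL.2 *m invmx UD.2)) ^+ 2).

Definition sr_dist (R : realType) (p : nat) (k : R) (X Y : 'M[R]_p) : R :=
  inf [set geo_dist k UD VL | UD in versions X & VL in versions Y].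

(* Column i has its 1 in row s i; the library's perm_mx s is the transpose. *)
Definition perm0_mx (R : realType) (p : nat) (s : 'S_p) : 'M[R]_p :=
  \matrix_(i, j) (i == s j)%:R.

Definition perm_rot (R : realType) (p : nat) (s : 'S_p) : 'M[R]_p :=
  if \det (perm0_mx R s) == 1 then perm0_mx R s
  else diag_mx (\row_(j < p) if j == 0%N :> nat then -1 else 1)
         *m perm0_mx R s.

Definition even_signs (R : realType) (p : nat) : set 'rV[R]_p :=
  [set e | (forall i, e 0 i = 1 \/ e 0 i = -1) /\ \prod_i e 0 i = 1].

Definition transform_version (R : realType) (p : nat)
    (UD : 'M[R]_p * 'M[R]_p) (e : 'rV[R]_p) (s : 'S_p) :
    'M[R]_p * 'M[R]_p :=
  (UD.1 *m diag_mx e *m (perm_rot R s)^T,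
   perm_rot R s *m UD.2 *m (perm_rot R s)^T).

(* Main.v *)
(* The pairs (e, s) act on versions, U being replaced by U I_e P_s' and D by
   P_s D P_s'. Acting simultaneously on both arguments leaves V U' unchanged and
   permutes the entries of log (L D^-1), hence preserves d. For p = 2 the versions
   of a matrix with distinct eigenvalues form a single orbit of size four, so any
   pair of versions can be moved to one whose second member is the given
   (V, L). If X = d1 I, its versions are all the (U, d1 I); the diagonal part of d
   then only depends on the spectrum of Y, and U = V annihilates the rotation
   part. *)
Require Import Defs.
From mathcomp Require Import ring lra.

Set Implicit Arguments.
Unset Strict Implicit.
Unset Printing Implicit Defensive.

(** * Signed permutations acting on pairs (U, D), in any dimension *)

Section Versions.
Variables (R : realType) (p : nat).
Implicit Types (U V Q : 'M[R]_p) (d l e : 'rV[R]_p) (s : 'S_p).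

(** Both branches of [perm_rot] take one shape, so later arguments need no case split on the
    determinant. *)
Lemma perm_rotE s : exists2 g : 'rV[R]_p,
  forall i, g 0 i * g 0 i = 1 &
  perm_rot R s = diag_mx g *m perm0_mx R s.
Proof.
rewrite /perm_rot; case: ifP => _.
  exists (const_mx 1) => [i|]; first by rewrite mxE mulr1.
  by rewrite diag_const_mx mul1mx.
exists (\row_(j < p) if j == 0%N :> nat then -1 else 1) => // i.
by rewrite mxE; case: ifP => _; rewrite ?mulrNN mulr1.
Qed.

Lemma perm0_mxE s : perm0_mx R s = perm_mx s^-1.
Proof.
apply/matrixP => i j; rewrite !mxE; congr (_ %:R); congr nat_of_bool.
by apply/eqP/eqP => [->|<-]; rewrite ?permK ?permKV.
Qed.

(** Each diagonal entry meets its sign [g 0 i] twice, so the sign correction disappears and only the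
    permutation acts on the diagonal. *)
Lemma perm_rot_conj s d : perm_rot R s *m diag_mx d *m (perm_rot R s)^T =
  diag_mx (col_perm s^-1 d).
Proof.
have [g g2 ->] := perm_rotE s.
have -> : diag_mx g *m perm0_mx R s *m diag_mx d *m
    (diag_mx g *m perm0_mx R s)^T =
  diag_mx g *m (perm0_mx R s *m diag_mx d *m (perm0_mx R s)^T) *m diag_mx g.
  by rewrite trmx_mul tr_diag_mx !mulmxA.
rewrite perm0_mxE -row_permE tr_perm_mx -col_permE.
apply/matrixP => i j; rewrite mul_mx_diag mul_diag_mx !mxE.
rewrite (inj_eq perm_inj); case: eqP => [->|_]; last by rewrite mulr0 mul0r.
by rewrite !mulr1n mulrAC g2 mul1r.
Qed.

Lemma perm_rot_orthogonal s : perm_rot R s *m (perm_rot R s)^T = 1%:M.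
Proof.
have := perm_rot_conj s (const_mx 1); rewrite diag_const_mx mulmx1 => ->.
by rewrite -diag_const_mx; congr diag_mx; apply/matrixP => i j; rewrite !mxE.
Qed.

Lemma rotationsM U V : rotations U -> rotations V -> rotations (U *m V).
Proof.
move=> [UU dU] [VV dV]; split; last by rewrite det_mulmx dU dV mulr1.
by rewrite trmx_mul mulmxA -(mulmxA U) VV mulmx1.
Qed.

Lemma rotationsT U : rotations U -> rotations U^T.
Proof.
by move=> [UU dU]; split; [rewrite trmxK (mulmx1C UU) | rewrite det_tr].
Qed.

Lemma even_signs_sqr e i : even_signs e -> e 0 i * e 0 i = 1.
Proof. by move=> [/(_ i) + _]; case=> ->; rewrite ?mulrNN mulr1. Qed.

Lemma even_signs_conj e d : even_signs e ->
  diag_mx e *m diag_mx d *m diag_mx e = diag_mx d.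
Proof.
move=> he; rewrite !mulmx_diag; congr diag_mx; apply/rowP => i.
by rewrite !mxE mulrAC even_signs_sqr // mul1r.
Qed.

Lemma even_signs_orthogonal e : even_signs e -> diag_mx e *m diag_mx e = 1%:M.
Proof.
by move=> he; have := even_signs_conj (const_mx 1) he;
  rewrite diag_const_mx mulmx1.
Qed.

Lemma even_signs_rotations e : even_signs e -> rotations (diag_mx e).
Proof.
move=> he; split; first by rewrite tr_diag_mx even_signs_orthogonal.
by case: he => _; rewrite det_diag.
Qed.

Lemma pos_diagP (D : 'M[R]_p) :
  pos_diag D <-> exists2 d, D = diag_mx d & forall i, 0 < d 0 i.
Proof.
split=> [[/diag_mxP[d ->] dpos]|[d -> dpos]].
  by exists d => // i; have := dpos i; rewrite mxE eqxx mulr1n.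
by split=> [|i]; rewrite ?diag_mx_is_diag // mxE eqxx mulr1n.
Qed.

Lemma frobenius_diag_log (D : 'M[R]_p) :
  frobenius (diag_log D) ^+ 2 = \sum_i ln (D i i) ^+ 2.
Proof.
rewrite /frobenius sqr_sqrtr; last first.
  by apply: sumr_ge0 => i _; apply: sumr_ge0 => j _; exact: sqr_ge0.
apply: eq_bigr => i _; rewrite (bigD1 i) //= big1 => [|j ji].
  by rewrite addr0 !mxE eqxx mulr1n.
by rewrite !mxE eq_sym (negbTE ji) mulr0n expr0n.
Qed.

Lemma invmx_diag d : (forall i, 0 < d 0 i) ->
  invmx (diag_mx d) = diag_mx (\row_i (d 0 i)^-1).
Proof.
move=> dpos; set d' := \row_i _.
have dd' : diag_mx d *m diag_mx d' = 1%:M.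
  rewrite mulmx_diag -diag_const_mx; congr diag_mx; apply/rowP => i.
  by rewrite !mxE mulfV // gt_eqF.
by have [du _] := mulmx1_unit dd'; rewrite -[LHS]mulmx1 -dd' mulKmx.
Qed.

Lemma geo_dist_diag k U V d l : (forall i, 0 < d 0 i) ->
  geo_dist k (U, diag_mx d) (V, diag_mx l) =
  Num.sqrt (k / 2 * frobenius (rot_log (V *m U^T)) ^+ 2
            + \sum_i ln (l 0 i / d 0 i) ^+ 2).
Proof.
move=> dpos; rewrite /geo_dist /= frobenius_diag_log invmx_diag //.
congr (Num.sqrt (_ + _)); apply: eq_bigr => i _.
by rewrite mulmx_diag !mxE eqxx mulr1n.
Qed.

Lemma geo_dist_transform k (UD VL : 'M[R]_p * 'M[R]_p) e s :
  pos_diag UD.2 -> pos_diag VL.2 -> even_signs e ->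
  geo_dist k (transform_version UD e s) (transform_version VL e s) =
  geo_dist k UD VL.
Proof.
case: UD VL => [U D] [V L] /= /pos_diagP[d -> dpos] /pos_diagP[l -> lpos] he.
rewrite /transform_version /= !perm_rot_conj !geo_dist_diag //; last first.
  by move=> i; rewrite mxE.
have -> : V *m diag_mx e *m (perm_rot R s)^T *m
    (U *m diag_mx e *m (perm_rot R s)^T)^T = V *m U^T.
  rewrite !trmx_mul trmxK tr_diag_mx !mulmxA -(mulmxA _ _ (perm_rot R s)).
  rewrite (mulmx1C (perm_rot_orthogonal s)) mulmx1 -(mulmxA V).
  by rewrite even_signs_orthogonal // mulmx1.
(* Both diagonals are permuted by the same [s^-1], so the sum of squared logarithms is only
   reordered. *)
congr (Num.sqrt (_ + _)); rewrite [RHS](reindex_inj (@perm_inj _ s^-1%g)) /=.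
by apply: eq_bigr => i _; rewrite !mxE.
Qed.

(** With distinct entries in [d], the permuted diagonal determines [s]; cancelling the invertible
    factors [U] and [perm_rot R s] then recovers [e]. *)
Lemma transform_version_inj U d e e' s s' : U \in unitmx ->
  injective (d 0) ->
  transform_version (U, diag_mx d) e s = transform_version (U, diag_mx d) e' s' ->
  e = e' /\ s = s'.
Proof.
move=> Uu dinj; rewrite /transform_version /= !perm_rot_conj => -[UeP dd].
have ss' : s = s'.
  apply: (can_inj invgK); apply/permP => i; apply: dinj.
  by have /matrixP/(_ i i) := dd; rewrite !mxE eqxx !mulr1n.
split=> //; move: UeP; rewrite -ss' => /(congr1 (mulmxr (perm_rot R s))) /=.
rewrite -!mulmxA (mulmx1C (perm_rot_orthogonal s)) !mulmx1.
move=> /(congr1 (mulmx (invmx U))); rewrite !mulKmx // => /matrixP ee'.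
by apply/rowP => i; have := ee' i i; rewrite !mxE eqxx !mulr1n.
Qed.

End Versions.

(** * Signed permutations map versions to versions *)

Section PositiveDimension.
Variables (R : realType) (n : nat).

(** A permutation matrix has determinant 1 or -1, and in the second case the correcting factor
    contributes -1, read off at index 0; writing the dimension as [n.+1] exposes that index. *)
Lemma perm_rot_rotations (s : 'S_n.+1) : rotations (perm_rot R s).
Proof.
split; first exact: perm_rot_orthogonal.
rewrite /perm_rot; case: ifP => [/eqP //|].
rewrite det_mulmx det_diag perm0_mxE det_perm big_ord_recl mxE /= big1 => [|i _].
  by rewrite mulr1; case: odd_perm; rewrite ?expr1 ?expr0 ?mulrNN ?mulr1 ?eqxx.
by rewrite mxE.
Qed.

(** In the new product the factors P'P cancel on both sides of D, and the signs then cancel because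
    they commute with D and square to 1. *)
Lemma transform_versions (X : 'M[R]_n.+1) (UD : 'M[R]_n.+1 * 'M[R]_n.+1) e s :
  versions X UD -> even_signs e -> versions X (transform_version UD e s).
Proof.
case: UD => U D [/= rU /pos_diagP[d Dd dpos] ->] he; split=> /=.
- apply: rotationsM; last exact/rotationsT/perm_rot_rotations.
  by apply: rotationsM => //; exact: even_signs_rotations.
- rewrite Dd perm_rot_conj; apply/pos_diagP; exists (col_perm s^-1 d) => // i.
  by rewrite mxE.
set P := perm_rot R s; have PP : P^T *m P = 1%:M.
  exact/mulmx1C/perm_rot_orthogonal.
rewrite !trmx_mul tr_diag_mx trmxK !mulmxA.
rewrite -(mulmxA _ P^T P) PP mulmx1 -(mulmxA _ P^T P) PP mulmx1.
by rewrite Dd -!mulmxA (mulmxA (diag_mx d)) (mulmxA (diag_mx e)) mulmxA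
  (mulmxA _ _ (diag_mx e)) even_signs_conj // -mulmxA.
Qed.

End PositiveDimension.

(** * Versions from diagonalization, and the logarithm of the identity *)

Section Spectral.
Variables (R : realType) (p : nat).

(* The diagonal of U^T X U consists of the values at the columns of U of the
   quadratic form of X. *)
Lemma diagonalizing_version (X U : 'M[R]_p) : sym_posdef X -> rotations U ->
  is_diag_mx (U^T *m X *m U) -> versions X (U, U^T *m X *m U).
Proof.
move=> [_ Xpos] rU dU; have [UU _] := rU; split=> //=; last first.
  by rewrite !mulmxA UU mul1mx -mulmxA UU mulmx1.
split=> // i; have -> : (U^T *m X *m U) i i = ((col i U)^T *m X *m col i U) 0 0.
  by rewrite tr_col -!row_mul !mxE; apply: eq_bigr => j _; rewrite !mxE.
apply: Xpos; apply/eqP => Ui0; have [/matrixP/(_ i i)] := mulmx1C UU.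
rewrite !mxE eqxx big1 => [/esym/eqP|j _]; first by rewrite oner_eq0.
by have /matrixP/(_ j 0) := Ui0; rewrite !mxE => ->; rewrite mulr0.
Qed.

(** The zero matrix is a logarithm of the identity, so whichever minimal logarithm is chosen has
    norm at most 0. *)
Lemma frobenius_rot_log1 : frobenius (rot_log (1%:M : 'M[R]_p)) = 0.
Proof.
have f0 : frobenius (0 : 'M[R]_p) = 0.
  rewrite /frobenius big1 ?sqrtr0 // => i _; rewrite big1 // => j _.
  by rewrite mxE expr0n.
have log1 : is_rot_log (1%:M : 'M[R]_p) 0.
  split; first by rewrite trmx0 oppr0.
    (* The partial sums are constant only from [n = 1] on: the sum at 0 is empty, and afterwards the
       term of exponent 0 is the sole nonzero one. *)
    rewrite /expmx; apply: norm_lim_near_cst; exists 1%N => // n /= n1.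
    rewrite /series /= big_ltn // expr0 fact0 invr1 scale1r big_nat big1 ?addr0//.
    by case=> // i _; rewrite expr0n scaler0.
  by move=> B _ _; rewrite f0 sqrtr_ge0.
have [_ _ /(_ 0)] := @xgetPex _ 0 _ (ex_intro (is_rot_log 1%:M) 0 log1).
case: log1 => h1 h2 _ /(_ h1 h2); rewrite f0 => le0.
by apply/le_anti; rewrite le0 sqrtr_ge0.
Qed.

End Spectral.

Lemma inf_eq_min (R : realType) (S : set R) m :
  S m -> lbound S m -> inf S = m.
Proof.
move=> Sm mS; apply/le_anti/andP; split; first by apply: ge_inf => //; exists m.
by apply: lb_le_inf => //; exists m.
Qed.

(** * The plane: explicit rotations, orbits of versions, and eigenvalues *)

Section TwoByTwo.
Variable R : realType.
Implicit Types (A B U V X : 'M[R]_2) (d l e : 'rV[R]_2).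

Lemma ord2_ind (P : 'I_2 -> Prop) : P 0 -> P 1 -> forall i, P i.
Proof.
by move=> P0 P1 [[|[|]]]// i2; [move: P0|move: P1]; congr P; apply: val_inj.
Qed.

Lemma mx2P A B : A 0 0 = B 0 0 -> A 0 1 = B 0 1 -> A 1 0 = B 1 0 ->
  A 1 1 = B 1 1 -> A = B.
Proof.
by move=> *; apply/matrixP; apply: ord2_ind; apply: ord2_ind.
Qed.

Lemma sum2 (F : 'I_2 -> R) : \sum_i F i = F 0 + F 1.
Proof.
by rewrite !big_ord_recl big_ord0 addr0; congr (_ + F _); apply: val_inj.
Qed.

Lemma mulmx2 A B i j : (A *m B) i j = A i 0 * B 0 j + A i 1 * B 1 j.
Proof. by rewrite mxE sum2. Qed.

Lemma det_mx2 A : \det A = A 0 0 * A 1 1 - A 0 1 * A 1 0.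
Proof.
rewrite (expand_det_row _ 0) sum2 /cofactor !det_mx11 !mxE /=.
have -> : lift 0 0 = 1 :> 'I_2 by apply: val_inj.
have -> : lift 1 0 = 0 :> 'I_2 by apply: val_inj.
by rewrite expr0 mul1r expr1 mulN1r mulrN.
Qed.

Lemma rotations2P U : rotations U <->
  [/\ U 0 0 ^+ 2 + U 1 0 ^+ 2 = 1, U 1 1 = U 0 0 & U 0 1 = - U 1 0].
Proof.
split=> [[UU]|[n1 h11 h01]].
  rewrite det_mx2 => dU.
  have := congr1 (fun M : 'M[R]_2 => M 0 0) UU.
  have := congr1 (fun M : 'M[R]_2 => M 0 1) UU.
  have := congr1 (fun M : 'M[R]_2 => M 1 1) UU.
  rewrite !mulmx2 !mxE /= => h11 h01 h00.
  move: (U 0 0) (U 0 1) (U 1 0) (U 1 1) h11 h01 h00 dU => a b c d.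
  rewrite !mulr1n mulr0n => h11 h01 h00 dU.
  (* Here and for [bc], the entry is multiplied by the squared norm 1 of a row and the product is
     regrouped around the determinant and the inner product of the two rows. *)
  have da : d = a.
    transitivity (d * (a * a + b * b)); first by rewrite h00 mulr1.
    transitivity (a * (a * d - b * c) + b * (a * c + b * d)); first by ring.
    by rewrite dU h01 mulr1 mulr0 addr0.
  have bc : b = - c.
    transitivity (b * (c * c + d * d)); first by rewrite h11 mulr1.
    transitivity (d * (a * c + b * d) - c * (a * d - b * c)); first by ring.
    by rewrite dU h01 mulr1 mulr0 sub0r.
  by split=> //; rewrite -h11 da !expr2 addrC.
split; last by rewrite det_mx2 h11 h01 -n1; ring.
by apply: mx2P; rewrite !mulmx2 !mxE /= ?mulr1n ?mulr0n ?h11 ?h01 -?n1; ring.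
Qed.

Lemma perm_rot1 : perm_rot R (1%g : 'S_2) = 1%:M.
Proof. by rewrite /perm_rot perm0_mxE invg1 perm_mx1 det1 eqxx. Qed.

Lemma perm_rot_tperm : let P := perm_rot R (tperm 0 1 : 'S_2) in
  [/\ P 0 0 = 0, P 0 1 = -1, P 1 0 = 1 & P 1 1 = 0].
Proof.
rewrite /= /perm_rot.
have -> : (\det (perm0_mx R (tperm 0 1 : 'S_2)) == 1) = false.
  by rewrite det_mx2 !mxE !permE /=; apply/negbTE; rewrite lt_eqF//; lra.
by split; rewrite mul_diag_mx !mxE !permE /= ?mulr0 ?mulr1.
Qed.

(* The indices 0, ..., 3 stand for (I, id), (-I, id), (I, swap), (-I, swap). *)
Definition orbit_signs (i : 'I_4) : 'rV[R]_2 := const_mx ((-1) ^+ i).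

Definition orbit_perm (i : 'I_4) : 'S_2 := if (i < 2)%N then 1%g else tperm 0 1.

Lemma orbit_signs_even i : even_signs (orbit_signs i).
Proof.
rewrite /orbit_signs -signr_odd; split.
  by move=> j; rewrite mxE; case: odd; [right|left].
by rewrite !big_ord_recl big_ord0 !mxE mulr1; case: odd;
  rewrite ?expr1 ?mulrNN ?mulr1.
Qed.

Lemma orbit_inj i j :
  orbit_signs i = orbit_signs j -> orbit_perm i = orbit_perm j -> i = j.
Proof.
have e1 : (1%g : 'S_2) <> tperm 0 1.
  by move=> /permP/(_ 0); rewrite permE tpermL => /eqP.
have m1 : (1 : R) <> -1 by lra.
move=> /matrixP/(_ 0 0); rewrite !mxE -!(signr_odd R i) -!(signr_odd R j).
rewrite /orbit_perm; case: i j => [[|[|[|[|]]]]]// ? [[|[|[|[|]]]]]// ? /= + +;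
  rewrite ?expr1 ?expr0 => h1 h2;
  first [exact: val_inj | by case: (m1 h1) | by case: (m1 (esym h1))
        | by case: (e1 h2) | by case: (e1 (esym h2))].
Qed.

(** The rotation Q = U'V satisfies DQ = QL, so a nonzero [Q i j] forces [d 0 i = l 0 j]. Since the
    entries of D differ, Q cannot have two nonzero entries in one column; a plane rotation of this
    kind is plus or minus the identity or a quarter turn. *)
Lemma versions_orbit X UD VL : versions X UD -> versions X VL ->
  UD.2 0 0 != UD.2 1 1 ->
  exists i, VL = transform_version UD (orbit_signs i) (orbit_perm i).
Proof.
case: UD VL => [U D] [V L] [/= rU /pos_diagP[d -> dpos] XU].
move=> [/= rV /pos_diagP[l -> lpos] XV]; rewrite !mxE /= !mulr1n => d01.
have [UU _] := rU; have [VV _] := rV.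
set Q := U^T *m V.
have VUQ : V = U *m Q by rewrite /Q mulmxA UU mul1mx.
have /rotations2P[n1 Q11 Q01] : rotations Q by apply/rotationsM/rV/rotationsT.
have dQ : diag_mx d *m Q = Q *m diag_mx l.
  transitivity (U^T *m X *m V); last first.
    by rewrite XV /Q -!mulmxA (mulmx1C VV) mulmx1.
  by rewrite XU /Q !mulmxA (mulmx1C UU) mul1mx.
have dQE i j : d 0 i * Q i j = Q i j * l 0 j.
  by have /matrixP/(_ i j) := dQ; rewrite mul_diag_mx mul_mx_diag !mxE.
have := dQE 0 0; have := dQE 0 1; have := dQE 1 0; have := dQE 1 1.
rewrite Q11 Q01 => d11 d10 d01' d00.
suff [i [Ql Pl]] : exists i : 'I_4, Q = (-1) ^+ i *: (perm_rot R (orbit_perm i))^T /\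
    forall j, l 0 j = d 0 ((orbit_perm i)^-1%g j).
  exists i; rewrite /transform_version /= perm_rot_conj VUQ Ql /orbit_signs.
  rewrite diag_const_mx -mulmxA mul_scalar_mx; congr (_, diag_mx _).
  by apply/rowP => j; rewrite Pl mxE.
have [s0|s0] := eqVneq (Q 1 0) 0.
  move: n1; rewrite s0 expr0n addr0 => /eqP; rewrite sqrf_eq1 => c1.
  have c0 : Q 0 0 != 0 by case/orP: c1 => /eqP ->; rewrite ?oppr_eq0 oner_eq0.
  have l0 : l 0 0 = d 0 0 by apply: (mulfI c0); rewrite -d00 mulrC.
  have l1 : l 0 1 = d 0 1 by apply: (mulfI c0); rewrite -d11 mulrC.
  have Pl : forall j, l 0 j = d 0 ((1%g : 'S_2)^-1%g j).
    by apply: ord2_ind; rewrite invg1 perm1.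
  case/orP: c1 => /eqP c1; [exists 0|exists 1]; split=> //;
    rewrite /orbit_perm /= perm_rot1 trmx1; apply: mx2P;
    rewrite ?Q11 ?Q01 ?s0 ?c1 !mxE /=; ring.
have l0 : l 0 0 = d 0 1 by apply: (mulfI s0); rewrite -d10 mulrC.
have l1 : l 0 1 = d 0 0.
  by apply: (mulfI s0); apply: oppr_inj; rewrite -mulNr -d01' mulrN mulrC.
(* A nonzero [Q 0 0] would give [l 0 0 = d 0 0], whereas [l 0 0 = d 0 1] already. *)
have c0 : Q 0 0 = 0.
  apply/eqP; apply: contraNT d01 => c0; apply/eqP; apply: (mulfI c0).
  by rewrite -l0 mulrC d00.
have Pl : forall j, l 0 j = d 0 ((tperm 0%R 1%R : 'S_2)^-1%g j).
  by apply: ord2_ind; rewrite tpermV ?tpermL ?tpermR.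
have [P00 P01 P10 P11] := perm_rot_tperm.
move: n1; rewrite c0 expr0n add0r => /eqP; rewrite sqrf_eq1.
(* The transposed swap rotation has -1 in row 1, column 0, so [Q 1 0 = 1] requires the negative
   sign, hence index 3. *)
case/orP=> /eqP s1; [exists (@Ordinal 4 3 isT)|exists (@Ordinal 4 2 isT)];
  split=> //; rewrite /orbit_perm /=; apply: mx2P;
  rewrite ?Q11 ?Q01 ?s1 ?c0 !mxE ?P00 ?P01 ?P10 ?P11 /=; ring.
Qed.

(** This is the spectral theorem in the plane, with an explicit eigenvector; by symmetry it suffices
    to annihilate one off-diagonal entry. *)
Lemma versions_nonempty X : sym_posdef X -> exists UD, versions X UD.
Proof.
move=> hX; suff [U rU U0] : exists2 U, rotations U & (U^T *m X *m U) 0 1 = 0.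
  exists (U, U^T *m X *m U); apply: diagonalizing_version => //.
  have [XT _] := hX.
  have sym : (U^T *m X *m U)^T = U^T *m X *m U.
    by rewrite !trmx_mul trmxK XT mulmxA.
  apply/is_diag_mxP; apply: ord2_ind; apply: ord2_ind => //.
  by rewrite -sym mxE.
have X10 : X 1 0 = X 0 1 by case: hX => XT _; rewrite -[in LHS]XT mxE.
set a := X 0 0; set b := X 0 1; set c := X 1 1.
(* A diagonal X is treated apart, because the vector (b, v) used below can vanish when b = 0. *)
have [b0|b0] := eqVneq b 0.
  exists 1%:M; first by apply/rotations2P; rewrite !mxE /=; split => //; ring.
  by rewrite trmx1 mul1mx mulmx1.
(* (b, v) is an eigenvector of X for the eigenvalue a + v. *)
pose r := Num.sqrt ((a - c) ^+ 2 + 4 * b ^+ 2); pose v := (c - a + r) / 2.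
have r2 : r ^+ 2 = (a - c) ^+ 2 + 4 * b ^+ 2.
  by rewrite sqr_sqrtr //; apply: addr_ge0; [exact: sqr_ge0 | nra].
(* The number [v] is a root of t^2 - (c - a) t - b^2, whose discriminant is [r ^+ 2]. *)
have v2 : v ^+ 2 = b ^+ 2 + v * (c - a).
  by rewrite /v expr_div_n sqrrD r2; field.
pose n := Num.sqrt (b ^+ 2 + v ^+ 2).
have npos : 0 < b ^+ 2 + v ^+ 2.
  by rewrite ltr_pwDl ?sqr_ge0 // exprn_even_gt0.
have n2 : n ^+ 2 = b ^+ 2 + v ^+ 2 by rewrite sqr_sqrtr // ltW.
have n0 : n != 0 by rewrite gt_eqF // sqrtr_gt0.
(* The columns are the normalized vector (b, v) and its quarter turn (-v, b). *)
pose U : 'M[R]_2 := \matrix_(i, j)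
  ((if i == j then b else if i == 0 then - v else v) / n).
exists U.
  apply/rotations2P; rewrite !mxE /=; split=> //; last by rewrite mulNr.
  by rewrite !(expr_div_n _ n) -mulrDl n2 mulfV // gt_eqF.
rewrite !mulmx2 !mxE /= X10 -/a -/b -/c.
transitivity (b * (b ^+ 2 + v * (c - a) - v ^+ 2) / n ^+ 2); first by field.
by rewrite -v2 subrr mulr0 mul0r.
Qed.

(** Trace and determinant show that the entries of [d] have the sum and product of [x] and [y]; thus
    [d 0 0] is a root of (t - x)(t - y), and the sum gives the other entry. *)
Lemma versions_eigenvalues X U d x y : versions X (U, diag_mx d) ->
  char_poly X = ('X - x%:P) * ('X - y%:P) ->
  (d 0 0 = x /\ d 0 1 = y) \/ (d 0 0 = y /\ d 0 1 = x).
Proof.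
move=> [/= [UU dU] _ XE] hX.
have trE : d 0 0 + d 0 1 = x + y.
  have := char_poly_trace X isT; rewrite XE mxtrace_mulC mulmxA (mulmx1C UU).
  rewrite mul1mx mxtrace_diag sum2 -XE hX => /esym/(congr1 -%R).
  rewrite opprK => ->; rewrite coefM !big_ord_recl big_ord0 /=.
  by rewrite !coefB !coefX !coefC /=; ring.
have detE : d 0 0 * d 0 1 = x * y.
  have := char_poly_det X; rewrite hX.
  rewrite XE !det_mulmx det_tr dU mul1r mulr1 sqrrN expr1n mul1r det_mx2 !mxE /=.
  rewrite !mulr1n mulr0n mul0r subr0 => <-.
  by rewrite coefM !big_ord_recl big_ord0 /= !coefB !coefX !coefC /=; ring.
have /eqP : (d 0 0 - x) * (d 0 0 - y) = 0.
  transitivity (d 0 0 * d 0 0 - d 0 0 * (x + y) + x * y); first by ring.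
  by rewrite -trE -detE; ring.
rewrite mulf_eq0 !subr_eq0 => /orP[]/eqP dx; [left|right]; split=> //.
  by apply: (addrI x); rewrite -trE dx.
by apply: (addIr y); rewrite -trE dx addrC.
Qed.

Lemma versions_distinct X UD x y : versions X UD ->
  char_poly X = ('X - x%:P) * ('X - y%:P) -> x <> y ->
  UD.2 0 0 != UD.2 1 1.
Proof.
case: UD => U D XUD hX xy; have [_ /= /pos_diagP[d Dd _] _] := XUD.
move: XUD; rewrite Dd /= !mxE /= !mulr1n => /versions_eigenvalues /(_ hX).
by case=> -[-> ->]; apply/eqP => // /esym.
Qed.

(** Together with [versions_range], this makes the number of versions exactly four. *)
Lemma orbit_transform_inj UD : rotations UD.1 -> pos_diag UD.2 ->
  UD.2 0 0 != UD.2 1 1 ->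
  injective (fun i => transform_version UD (orbit_signs i) (orbit_perm i)).
Proof.
case: UD => U D [UU _] /= /pos_diagP[d -> _]; rewrite !mxE /= !mulr1n => d01.
have Uu : U \in unitmx by have [] := mulmx1_unit UU.
have dinj : injective (d 0).
  by apply: ord2_ind; apply: ord2_ind => // /eqP; rewrite ?[d 0 1 == _]eq_sym (negbTE d01).
by move=> i j /(transform_version_inj Uu dinj)[]; exact: orbit_inj.
Qed.

Lemma versions_range X UD : versions X UD -> UD.2 0 0 != UD.2 1 1 ->
  versions X =
    range (fun i => transform_version UD (orbit_signs i) (orbit_perm i)).
Proof.
move=> XUD d01; apply/seteqP; split=> [VL XVL|_ [i _ <-]].
  by have [i ->] := versions_orbit XUD XVL d01; exists i.
by apply: transform_versions => //; exact: orbit_signs_even.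
Qed.

Lemma versions_transforms X UD : versions X UD -> UD.2 0 0 != UD.2 1 1 ->
  versions X = [set transform_version UD e s |
                 e in @even_signs R 2 & s in [set: 'S_2]%classic].
Proof.
move=> XUD d01; apply/seteqP; split=> [VL XVL|_ [e he [s _ <-]]].
  have [i ->] := versions_orbit XUD XVL d01.
  by exists (orbit_signs i); [exact: orbit_signs_even|exists (orbit_perm i)].
exact: transform_versions.
Qed.

(* Moving a pair of versions by the element of the transformation group that
   takes the second one to VL preserves its distance. *)
Lemma sr_dist_min k X Y n (W : 'I_n.+1 -> 'M[R]_2 * 'M[R]_2) VL :
  versions X = range W -> versions Y VL ->
  (forall VL', versions Y VL' -> VL'.2 0 0 != VL'.2 1 1) ->
  sr_dist k X Y =
    \big[Num.min/geo_dist k (W ord0) VL]_(i < n.+1) geo_dist k (W i) VL.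
Proof.
move=> XW YVL distinct; have XWi i : versions X (W i) by rewrite XW; exists i.
apply: inf_eq_min.
  set F := fun i => geo_dist k (W i) VL; set x := F ord0.
  (* The initial value of the iterated minimum is itself [F ord0], so the minimum is attained at
     some index. *)
  have [i ->] : exists i, \big[Num.min/x]_i F i = F i.
    apply: (big_ind (fun z => exists i, z = F i)) => [|_ _ [i ->] [j ->]|i _].
    - by exists ord0.
    - by case: (leP (F i) (F j)) => _; [exists i|exists j].
    - by exists i.
  by exists (W i) => //; exists VL.
move=> _ [UD XUD [VL' YVL' <-]].
have [i VLE] := versions_orbit YVL' YVL (distinct _ YVL').
have he := orbit_signs_even i.
(* The element taking VL' to VL moves UD to another version of X, which is therefore some [W j]. *)
have : versions X (transform_version UD (orbit_signs i) (orbit_perm i)).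
  exact: transform_versions.
rewrite XW => -[j _ Wj]; apply: (@bigmin_inf _ _ _ _ j) => //.
rewrite Wj [in leLHS]VLE geo_dist_transform //; last by case: YVL'.
by case: XUD.
Qed.

End TwoByTwo.

Arguments orbit_signs {R} i.

Theorem theorem4p1 (R : realType) (k : R) (k_gt0 : 0 < k)
    (X Y : 'M[R]_2) (hX : sym_posdef X) (hY : sym_posdef Y)
    (d1 d2 l1 l2 : R)
    (hd : char_poly X = ('X - d1%:P) * ('X - d2%:P))
    (hl : char_poly Y = ('X - l1%:P) * ('X - l2%:P)) :
  (d1 <> d2 -> l1 <> l2 ->
    exists W : 'I_4 -> 'M[R]_2 * 'M[R]_2,
      [/\ injective W,
          versions X = range W,
          forall VL, versions Y VL ->
            sr_dist k X Y =
              \big[Num.min/geo_dist k (W ord0) VL]_(i < 4) geo_dist k (W i) VL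
        & forall UD, versions X UD ->
            versions X =
              [set transform_version UD e s |
                e in @even_signs R 2 & s in [set: 'S_2]%classic]])
  /\
  (d1 = d2 -> forall VL, versions Y VL ->
    sr_dist k X Y = geo_dist k (VL.1, diag_mx (const_mx d1)) VL).
Proof.
have [UD XUD] := versions_nonempty hX; split=> [d12 l12|d12 [V L] YVL].
  have d01 := versions_distinct XUD hd d12.
  exists (fun i => transform_version UD (orbit_signs i) (orbit_perm i)); split.
  - by apply: orbit_transform_inj; case: XUD.
  - exact: versions_range.
  - move=> VL YVL; apply: sr_dist_min => //; first exact: versions_range.
    by move=> VL' YVL'; exact: versions_distinct hl l12.
  - move=> UD' XUD'; apply: versions_transforms => //.
    exact: versions_distinct hd d12.
(* A double eigenvalue leaves a single possible diagonal part, and its positivity gives that of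
   [d1]. *)
have XD U D : versions X (U, D) -> D = diag_mx (const_mx d1) /\ 0 < d1.
  move=> XU; have [_ /= /pos_diagP[d Dd dpos] _] := XU.
  move: XU; rewrite Dd => /versions_eigenvalues /(_ hd); rewrite -d12.
  have dE : d 0 0 = d1 -> d 0 1 = d1 -> diag_mx d = diag_mx (const_mx d1).
    by move=> e0 e1; congr diag_mx; apply/rowP; apply: ord2_ind; rewrite mxE.
  by case=> -[e0 e1]; rewrite dE // -e0.
case: UD XUD => U D XUD; have [DE d1pos] := XD _ _ XUD.
have XE : X = d1%:M.
  have [[UU _] _ /= ->] := XUD.
  by rewrite DE diag_const_mx mul_mx_scalar -scalemxAl UU scalemx1.
have [/= rV /pos_diagP[l Ll lpos] _] := YVL.
have dpos i : 0 < (const_mx d1 : 'rV[R]_2) 0 i by rewrite mxE.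
apply: inf_eq_min.
  (* As X is scalar, every rotation diagonalizes it; taking V itself realizes the infimum. *)
  exists (V, diag_mx (const_mx d1)); last by exists (V, L).
  split=> //=; first by apply/pos_diagP; exists (const_mx d1).
  have [VV _] := rV.
  by rewrite diag_const_mx mul_mx_scalar -scalemxAl VV scalemx1.
move=> _ [[U' D'] XUD' [[V' L'] YVL' <-]].
have [-> _] := XD _ _ XUD'.
have [/= _ /pos_diagP[l' Ll' _] _] := YVL'.
move: YVL YVL'; rewrite Ll Ll' => YVL YVL'.
have [VV _] := rV; rewrite !geo_dist_diag // VV frobenius_rot_log1.
rewrite expr0n mulr0 add0r ler_wsqrtr // !sum2 !mxE.
(* Two versions of Y carry the same eigenvalues up to order, and this sum is symmetric in them. What
   remains is the rotation term, nonnegative since [k] is positive. *)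
have -> : ln (l 0 0 / d1) ^+ 2 + ln (l 0 1 / d1) ^+ 2 =
          ln (l' 0 0 / d1) ^+ 2 + ln (l' 0 1 / d1) ^+ 2.
  case: (versions_eigenvalues YVL hl) => -[-> ->];
  by case: (versions_eigenvalues YVL' hl) => -[-> ->] //; rewrite addrC.
by rewrite lerDr mulr_ge0 ?sqr_ge0 // divr_ge0 // ltW.
Qed.
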